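(* (i) If $u_h\in\mathbb{R}^{N\times c}$ is a solution of the discrete PDE $$\mathcal F_h(u(z))=0\ \ (z\in\Omega^h),\qquad \mathcal B_h(u(z))=0\ \ (z\in\Gamma^h),$$ then it also solves $\min_{u\in\mathbb{R}^{N\times c}}\mathcal J_{\mathrm{FD}}(u)$ with $\mathcal J_{\mathrm{FD}}(u_h)=0$, provided that $\alpha_{\mathcal D}=0$, or $\alpha_{\mathcal D}>0$ and $u_h(z)=u^*(z)$ for all $z\in\mathcal D^h$. (ii) If $u_h\in\arg\min_{u\in\mathbb{R}^{N\times c}}\mathcal J_{\mathrm{FD}}(u)$ with $\mathcal J_{\mathrm{FD}}(u_h)=0$, then $u_h\in\mathbb{R}^{N\times c}$ solves the discrete PDE, i.e. $\mathcal F_h(u_h(z))=0$ for all $z\in\Omega^h$ and $\mathcal B_h(u_h(z))=0$ for all $z\in\Gamma^h$.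
   Context: $\Omega\subset\mathbb{R}^d$ is a bounded domain with Lipschitz boundary and $\Gamma\subseteq\partial\Omega$ is the portion of the boundary on which boundary conditions are prescribed. A PDE with boundary conditions, $\mathcal F(u)=0$ in $\Omega$ and $\mathcal B(u)=0$ on $\Gamma$, for an unknown $u:\overline\Omega\to\mathbb{R}^c$, is discretized by finite differences: $\mathcal F_h$, $\mathcal B_h$, $\Omega^h\subset\Omega$ and $\Gamma^h\subset\Gamma$ are finite-difference discretizations of $\mathcal F$, $\mathcal B$, $\Omega$ and $\Gamma$, respectively, with $\Omega^h\cap\Gamma^h=\emptyset$. The unknown $u\in\mathbb{R}^{N\times c}$ represents the discrete function values at the $N$ grid points of the stencil $\Omega^h\cup\Gamma^h$, and $u(z)\in\mathbb{R}^c$ is the value of $u$ at the grid point $z$. $\mathcal F_h(u(z))$ for $z\in\Omega^h$ and $\mathcal B_h(u(z))$ for $z\in\Gamma^h$ denote the values at $z$ of the discrete operators applied to the grid function $u$ (they may involve values of $u$ at neighbouring grid points). $\mathcal D^h\subseteq\Omega^h\cup\Gamma^h$ is the set of locations of measurement data $u^*$, with $u^*(z)\in\mathbb{R}^c$ for $z\in\mathcal D^h$. With $\nu\in[1,\infty)$, $|\cdot|_\nu$ the $\ell^\nu$-norm, $\alpha_{\mathcal F},\alpha_{\mathcal B},\alpha_{\mathcal D}\ge 0$, and suitable quadrature weights $\omega_{\mathcal F}^z,\omega_{\mathcal B}^z,\omega_{\mathcal D}^z$, define $$\mathcal J_{\mathrm{FD}}(u)=\alpha_{\mathcal F}\sum_{z\in\Omega^h}\omega_{\mathcal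 F}^z|\mathcal F_h(u(z))|_\nu^\nu+\alpha_{\mathcal B}\sum_{z\in\Gamma^h}\omega_{\mathcal B}^z|\mathcal B_h(u(z))|_\nu^\nu+\alpha_{\mathcal D}\sum_{z\in\mathcal D^h}\omega_{\mathcal D}^z|u(z)-u^*(z)|_\nu^\nu .$$
   Formalization: Part (ii) is proved assuming α_F > 0, α_B > 0 and strictly positive quadrature weights ω_F, ω_B; with only α ≥ 0 it fails (α_F = α_D = 0, F_h ≡ 1, B_h ≡ 0 gives J_FD ≡ 0). All weights are taken to be nonnegative. *)

(* Defs.v *)
From HB Require Import structures.
From mathcomp Require Import all_boot all_order all_algebra.
From mathcomp Require Import finmap.
From mathcomp Require Import all_classical all_reals all_analysis.

Set Implicit Arguments.
Unset Strict Implicit.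
Unset Printing Implicit Defensive.

Import Order.TTheory GRing.Theory Num.Theory.
Import numFieldNormedType.Exports.

Local Open Scope classical_set_scope.
Local Open Scope ring_scope.

Definition boundary (T : topologicalType) (A : set T) : set T :=
  closure A `\` interior A.

(* Near every boundary point there are orthonormal coordinates, given by an
   orthogonal matrix [Q] and a distinguished coordinate [i], in which [Omega]
   is the strict epigraph of a Lipschitz function of the other coordinates
   ([col' i y] deletes the [i]-th coordinate of [y]). *)
Definition lipschitz_boundary (R : realType) (d : nat) (Omega : set 'rV[R]_d)
    : Prop :=
  forall x0, boundary Omega x0 ->
  exists (Q : 'M[R]_d) (i : 'I_d) (phi : 'rV[R]_d.-1 -> R),
    [/\ Q *m Q^T = 1%:M,
        lipschitz phi &
        \forall x \near x0,
          let y := (x - x0) *m Q in Omega x <-> phi (col' i y) < y 0 i].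

Definition bounded_lipschitz_domain (R : realType) (d : nat)
    (Omega : set 'rV[R]_d) : Prop :=
  [/\ Omega !=set0, open Omega, connected Omega, bounded_set Omega
    & lipschitz_boundary Omega].

Definition lnorm (R : realType) (nu : R) (n : nat) (v : 'rV[R]_n) : R :=
  (\sum_(j < n) `|v 0 j| `^ nu) `^ nu^-1.

(* Grid functions on the finite stencil [G] are the [N x c] matrices with
   [N = #|{: G}|], the rows being indexed by the enumeration of [G]. *)
Notation grid_fun R G c := 'M[R]_(#|{: G}|, c).

Definition grid_val (R : realType) (T : choiceType) (G : {fset T}) (c : nat)
    (u : grid_fun R G c) (z : G) : 'rV[R]_c :=
  row (enum_rank z) u.

(* The discrete operators take the whole grid function, since their value at
   [z] may involve neighbouring grid points; [mF] and [mB] are the numbers of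
   scalar equations they impose at each point. *)
Definition discrete_pde (R : realType) (T : choiceType) (Oh Gh : {fset T})
    (c mF mB : nat)
    (Fh : grid_fun R (Oh `|` Gh)%fset c -> Oh -> 'rV[R]_mF)
    (Bh : grid_fun R (Oh `|` Gh)%fset c -> Gh -> 'rV[R]_mB)
    (u : grid_fun R (Oh `|` Gh)%fset c) : Prop :=
  (forall z : Oh, Fh u z = 0) /\ (forall z : Gh, Bh u z = 0).

(* [fincl hD : Dh -> Oh `|` Gh] is the inclusion of the data locations into
   the stencil. *)
Definition J_FD (R : realType) (T : choiceType) (Oh Gh Dh : {fset T})
    (hD : (Dh `<=` Oh `|` Gh)%fset) (c mF mB : nat)
    (Fh : grid_fun R (Oh `|` Gh)%fset c -> Oh -> 'rV[R]_mF)
    (Bh : grid_fun R (Oh `|` Gh)%fset c -> Gh -> 'rV[R]_mB)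
    (ustar : Dh -> 'rV[R]_c) (nu aF aB aD : R)
    (wF : Oh -> R) (wB : Gh -> R) (wD : Dh -> R)
    (u : grid_fun R (Oh `|` Gh)%fset c) : R :=
  aF * (\sum_(z : Oh) wF z * lnorm nu (Fh u z) `^ nu) +
  aB * (\sum_(z : Gh) wB z * lnorm nu (Bh u z) `^ nu) +
  aD * (\sum_(z : Dh)
          wD z * lnorm nu (grid_val u (fincl hD z) - ustar z) `^ nu).

Definition is_argmin (R : realType) (U : Type) (J : U -> R) (u : U) : Prop :=
  forall v, J u <= J v.

(* Main.v *)
Require Import Defs.
From HB Require Import structures.
From mathcomp Require Import all_boot all_order all_algebra.
From mathcomp Require Import finmap.
From mathcomp Require Import all_classical all_reals all_analysis.
Set Implicit Arguments.
Unset Strict Implicit.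
Unset Printing Implicit Defensive.
Import Order.TTheory GRing.Theory Num.Theory.
Import numFieldNormedType.Exports.
Local Open Scope classical_set_scope.
Local Open Scope ring_scope.

(** The functional combines three residuals with nonnegative coefficients, and
    each residual is itself a nonnegative combination of powers of norms.  It is
    thus bounded below by [0], and being a minimiser costs nothing once the
    value [0] is attained.  A solution of the discrete PDE attains it: the two
    equation residuals vanish, and the data residual disappears either through
    its coefficient or because the data are matched.  Conversely, a vanishing
    sum of nonnegative terms vanishes term by term ([residual_eq0]); dividing by
    the positive coefficients and weights leaves [lnorm nu _ `^ nu = 0] at every
    grid point, and the l^nu-norm is definite ([lnorm_powR_eq0]). *)

Lemma lnorm_powR_eq0 (R : realType) (nu : R) (n : nat) (v : 'rV[R]_n) :
  0 < nu -> (lnorm nu v `^ nu == 0) = (v == 0).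
Proof.
move=> nu_gt0; have nu_neq0 : nu != 0 by rewrite gt_eqF.
rewrite /lnorm !powR_eq0 invr_eq0 nu_neq0 !andbT.
rewrite psumr_eq0 => [|j _]; last exact: powR_ge0.
apply/allP/eqP => [v0|-> j _]; last first.
  by rewrite /= mxE normr0 powR_eq0 eqxx nu_neq0.
apply/rowP => j; rewrite mxE; apply/eqP.
by have := v0 j (mem_index_enum j); rewrite /= powR_eq0 normr_eq0 nu_neq0 andbT.
Qed.

Section Residual.
Variables (R : realType) (I : finType) (n : nat) (nu : R).
Variables (w : I -> R) (r : I -> 'rV[R]_n).

Let residual := \sum_(z : I) w z * lnorm nu (r z) `^ nu.

Lemma residual_ge0 : (forall z, 0 <= w z) -> 0 <= residual.
Proof. by move=> w_ge0; apply: sumr_ge0 => z _; rewrite mulr_ge0 ?powR_ge0. Qed.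

Lemma residual0 : 0 < nu -> (forall z, r z = 0) -> residual = 0.
Proof.
move=> nu_gt0 r0; apply: big1 => z _; apply/eqP.
by rewrite mulf_eq0 lnorm_powR_eq0 // r0 eqxx orbT.
Qed.

(** The weights are positive because a point of weight zero would
    leave [r] unconstrained. *)
Lemma residual_eq0 : 0 < nu -> (forall z, 0 < w z) -> residual = 0 ->
  forall z, r z = 0.
Proof.
move=> nu_gt0 w_gt0 /eqP; rewrite /residual psumr_eq0; last first.
  by move=> z _; rewrite mulr_ge0 ?powR_ge0 ?ltW.
move=> /allP res0 z; apply/eqP; rewrite -(lnorm_powR_eq0 _ nu_gt0).
by have := res0 z (mem_index_enum z); rewrite /= mulf_eq0 gt_eqF.
Qed.

End Residual.

Theorem proposition4p1 (R : realType) (d c mF mB : nat)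
  (Omega Gamma : set 'rV[R]_d)
  (hOmega : bounded_lipschitz_domain Omega)
  (hGamma : Gamma `<=` boundary Omega)
  (Oh Gh Dh : {fset 'rV[R]_d})
  (hOh : [set` Oh] `<=` Omega)
  (hGh : [set` Gh] `<=` Gamma)
  (hdisj : (Oh `&` Gh = fset0)%fset)
  (hD : (Dh `<=` Oh `|` Gh)%fset)
  (Fh : grid_fun R (Oh `|` Gh)%fset c -> Oh -> 'rV[R]_mF)
  (Bh : grid_fun R (Oh `|` Gh)%fset c -> Gh -> 'rV[R]_mB)
  (ustar : Dh -> 'rV[R]_c)
  (nu : R) (hnu : 1 <= nu)
  (aF aB aD : R) (haF : 0 <= aF) (haB : 0 <= aB) (haD : 0 <= aD)
  (wF : Oh -> R) (wB : Gh -> R) (wD : Dh -> R)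
  (hwF : forall z, 0 <= wF z) (hwB : forall z, 0 <= wB z)
  (hwD : forall z, 0 <= wD z) :
  let J := J_FD hD Fh Bh ustar nu aF aB aD wF wB wD in
  (forall uh : grid_fun R (Oh `|` Gh)%fset c,
     discrete_pde Fh Bh uh ->
     aD = 0 \/ (0 < aD /\ forall z : Dh, grid_val uh (fincl hD z) = ustar z) ->
     is_argmin J uh /\ J uh = 0)
  /\
  (0 < aF -> 0 < aB ->
   (forall z, 0 < wF z) -> (forall z, 0 < wB z) ->
   forall uh : grid_fun R (Oh `|` Gh)%fset c,
     is_argmin J uh -> J uh = 0 ->
     discrete_pde Fh Bh uh).
Proof.
move=> J; have nu_gt0 : 0 < nu := lt_le_trans ltr01 hnu.
split=> [uh [Fuh0 Buh0] data|aF_gt0 aB_gt0 wF_gt0 wB_gt0 uh _].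
  have J0 : J uh = 0.
    rewrite /J /J_FD (residual0 _ nu_gt0 Fuh0) (residual0 _ nu_gt0 Buh0) !mulr0 !add0r.
    case: data => [->|[_ uhE]]; first by rewrite mul0r.
    by rewrite residual0 ?mulr0 // => z; rewrite uhE subrr.
  split; last exact: J0.
  move=> v; rewrite J0 /J /J_FD.
  by apply: addr_ge0; first apply: addr_ge0; apply: mulr_ge0 => //; exact: residual_ge0.
have F_ge0 : 0 <= aF * \sum_(z : Oh) wF z * lnorm nu (Fh uh z) `^ nu.
  by apply: mulr_ge0 => //; exact: residual_ge0.
have B_ge0 : 0 <= aB * \sum_(z : Gh) wB z * lnorm nu (Bh uh z) `^ nu.
  by apply: mulr_ge0 => //; exact: residual_ge0.
have D_ge0 : 0 <= aD * \sum_(z : Dh)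
    wD z * lnorm nu (grid_val uh (fincl hD z) - ustar z) `^ nu.
  by apply: mulr_ge0 => //; exact: residual_ge0.
rewrite /J /J_FD => /eqP; rewrite paddr_eq0 ?(addr_ge0 F_ge0 B_ge0) //.
rewrite (paddr_eq0 F_ge0 B_ge0) !mulf_eq0 (gt_eqF aF_gt0) (gt_eqF aB_gt0) !orFb.
move=> /andP[/andP[/eqP Fuh0 /eqP Buh0] _].
split; first exact: (residual_eq0 nu_gt0 wF_gt0 Fuh0).
exact: (residual_eq0 nu_gt0 wB_gt0 Buh0).
Qed.
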